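(* Let $\ell$ be a positive integer, and let $D$ be the group generated by all decimations $d_k$, $k\in\mathbb{Z}_\ell^\times$, and all cyclic shifts $c_j$, $j\in\mathbb{Z}_\ell$, where the group operation is function composition. Then (i) $D\cong\mathbb{Z}_\ell\rtimes_\theta\mathbb{Z}_\ell^\times$; (ii) $\langle (i,1)\mid (i,1)\in\mathbb{Z}_\ell\rtimes_\theta\mathbb{Z}_\ell^\times,\ i\in\mathbb{Z}_\ell\rangle\cong\langle c_i\mid i\in\mathbb{Z}_\ell\rangle\cong\mathbb{Z}_\ell$; (iii) $\langle (0,k)\mid (0,k)\in\mathbb{Z}_\ell\rtimes_\theta\mathbb{Z}_\ell^\times,\ k\in\mathbb{Z}_\ell^\times\rangle\cong\langle d_k\mid k\in\mathbb{Z}_\ell^\times\rangle\cong\mathbb{Z}_\ell^\times$.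
   Context: $\mathbb{Z}_\ell$ is the ring of integers modulo $\ell$ (viewed as an additive group where appropriate), $\mathbb{Z}_\ell^\times$ its multiplicative group of units, and $\mathbb{C}^{\mathbb{Z}_\ell}$ the set of complex vectors indexed by $\mathbb{Z}_\ell$. For $j\in\mathbb{Z}_\ell$, the cyclic shift $c_j:\mathbb{C}^{\mathbb{Z}_\ell}\to\mathbb{C}^{\mathbb{Z}_\ell}$ is $(c_j(\mathbf{v}))_i=v_{i-j}$. For $k\in\mathbb{Z}_\ell^\times$, the decimation $d_k:\mathbb{C}^{\mathbb{Z}_\ell}\to\mathbb{C}^{\mathbb{Z}_\ell}$ is $(d_k(\mathbf{v}))_i=v_{ik^{-1}}$. The homomorphism $\theta:\mathbb{Z}_\ell^\times\to\mathrm{Aut}(\mathbb{Z}_\ell)$ is $\theta_k(i)=ki$, and $\mathbb{Z}_\ell\rtimes_\theta\mathbb{Z}_\ell^\times$ is the set $\mathbb{Z}_\ell\times\mathbb{Z}_\ell^\times$ with multiplication $(a_1,b_1)(a_2,b_2)=(a_1+b_1a_2,b_1b_2)$. The notation $\langle\cdot\rangle$ denotes the subgroup generated by the listed elements. *)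

(* Defs.v *)
From HB Require Import structures.
From mathcomp Require Import all_boot all_order all_fingroup all_algebra.
From mathcomp Require Import all_classical all_reals.
From mathcomp Require Import complex.

Set Implicit Arguments.
Unset Strict Implicit.
Unset Printing Implicit Defensive.

Import GRing.Theory.

Local Open Scope classical_set_scope.
Local Open Scope ring_scope.

(* The integers modulo l, for l > 0.  MathComp's 'Z_1 denotes Z/2 and 'I_1 has *)
(* no ring structure, so covering the modulus l = 1 takes this alias, with the *)
(* possibly trivial ring structure; as for 'Z_l, the type is only meaningful   *)
(* for positive l.  The group law (%g) inherited from 'I_l is addition mod l.  *)
Definition Zmod (l : nat) : Type := 'I_l.-1.+1.

HB.instance Definition _ (l : nat) := FinGroup.copy (Zmod l) 'I_l.-1.+1.
HB.instance Definition _ (l : nat) := GRing.Zmodule.copy (Zmod l) 'I_l.-1.+1.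
HB.instance Definition _ (l : nat) :=
  GRing.Zmodule_isComPzRing.Build (Zmod l)
    (@Zp_mulA l.-1.+1) (@Zp_mulC l.-1.+1) (@Zp_mul1z l.-1)
    (@Zp_mul_addl l.-1.+1).

Section Units.
Variable l : nat.

Definition invertible (k : Zmod l) : bool := [exists j : Zmod l, k * j == 1].

Record Zunit : Type := ZUnit { Zuval :> Zmod l; ZuvalP : invertible Zuval }.

HB.instance Definition _ := [isSub for Zuval].
HB.instance Definition _ := [Finite of Zunit by <:].

Lemma invertible1 : invertible 1.
Proof. by apply/existsP; exists 1; rewrite mulr1. Qed.

Lemma invertibleM (k m : Zunit) : invertible (Zuval k * Zuval m).
Proof.
have /existsP[k' /eqP kk'] := ZuvalP k; have /existsP[m' /eqP mm'] := ZuvalP m.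
by apply/existsP; exists (k' * m'); rewrite mulrACA kk' mm' mulr1.
Qed.

Lemma Zunit_mulVr (k : Zunit) : (Zp_inv (Zuval k) : Zmod l) * Zuval k = 1.
Proof.
have /existsP[j /eqP kj] := ZuvalP k.
by apply: Zp_mulVz; apply: (@Zp_intro_unit _ _ j); rewrite -[RHS]kj mulrC.
Qed.

Lemma invertibleV (k : Zunit) : invertible (Zp_inv (Zuval k) : Zmod l).
Proof. by apply/existsP; exists (Zuval k); rewrite Zunit_mulVr. Qed.

Definition Zunit_one : Zunit := ZUnit invertible1.
Definition Zunit_mul (k m : Zunit) : Zunit := ZUnit (invertibleM k m).
Definition Zunit_inv (k : Zunit) : Zunit := ZUnit (invertibleV k).

Fact Zunit_mulA : associative Zunit_mul.
Proof. by move=> k m p; apply/val_inj; rewrite /= mulrA. Qed.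
Fact Zunit_mul1 : left_id Zunit_one Zunit_mul.
Proof. by move=> k; apply/val_inj; rewrite /= mul1r. Qed.
Fact Zunit_mulV : left_inverse Zunit_one Zunit_inv Zunit_mul.
Proof. by move=> k; apply/val_inj; rewrite /= Zunit_mulVr. Qed.

HB.instance Definition _ :=
  Finite_isGroup.Build Zunit Zunit_mulA Zunit_mul1 Zunit_mulV.

End Units.

Section Semidirect.
Variable l : nat.

Definition theta (k : Zunit l) (i : Zmod l) : Zmod l := Zuval k * i.

Definition sdprodZ : Type := (Zmod l * Zunit l)%type.
HB.instance Definition _ := Finite.on sdprodZ.

Definition sdprodZ_one : sdprodZ := (0, 1%g).
Definition sdprodZ_mul (x y : sdprodZ) : sdprodZ :=
  (x.1 + theta x.2 y.1, (x.2 * y.2)%g).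
Definition sdprodZ_inv (x : sdprodZ) : sdprodZ :=
  (- theta x.2^-1%g x.1, x.2^-1%g).

Fact sdprodZ_mulA : associative sdprodZ_mul.
Proof.
move=> [a k] [b m] [c p]; congr (_, _); rewrite /= ?mulgA //.
by rewrite /theta mulrDr addrA mulrA.
Qed.
Fact sdprodZ_mul1 : left_id sdprodZ_one sdprodZ_mul.
Proof.
by move=> [a k]; congr (_, _); rewrite /= ?mul1g // /theta mul1r add0r.
Qed.
Fact sdprodZ_mulV : left_inverse sdprodZ_one sdprodZ_inv sdprodZ_mul.
Proof.
by move=> [a k]; congr (_, _); rewrite /= ?mulVg // addNr.
Qed.

HB.instance Definition _ :=
  Finite_isGroup.Build sdprodZ sdprodZ_mulA sdprodZ_mul1 sdprodZ_mulV.

End Semidirect.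

(* All bijections of an arbitrary, possibly infinite, type, as a group under   *)
(* composition; {perm T} is restricted to finite types.                        *)
Section Bijections.
Variable T : choiceType.

Record bijection : Type :=
  Bijection { bij_fun :> T -> T; bij_funP : `[< bijective bij_fun >] }.

HB.instance Definition _ := [isSub for bij_fun].
HB.instance Definition _ := [Choice of bijection by <:].

Lemma bijection_id : `[< bijective (@id T) >].
Proof. by apply/asboolP; exists id. Qed.
Lemma bijection_comp (f g : bijection) : `[< bijective (f \o g) >].
Proof. by apply/asboolP/bij_comp; apply/asboolP/bij_funP. Qed.

Lemma bijection_ex_inv (f : bijection) :
  exists g : T -> T, cancel f g /\ cancel g f.
Proof. by have /asboolP[g fK gK] := bij_funP f; exists g. Qed.

Definition bijection_inv_fun (f : bijection) : T -> T :=
  projT1 (cid (bijection_ex_inv f)).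
Lemma bijection_funK (f : bijection) : cancel f (bijection_inv_fun f).
Proof. by rewrite /bijection_inv_fun; case: cid => g []. Qed.
Lemma bijection_invK (f : bijection) : cancel (bijection_inv_fun f) f.
Proof. by rewrite /bijection_inv_fun; case: cid => g []. Qed.
Lemma bijection_inv_bij (f : bijection) : `[< bijective (bijection_inv_fun f) >].
Proof.
apply/asboolP; exists f; [exact: bijection_invK | exact: bijection_funK].
Qed.

Definition bijection_one : bijection := Bijection bijection_id.
Definition bijection_mul (f g : bijection) : bijection :=
  Bijection (bijection_comp f g).
Definition bijection_inv (f : bijection) : bijection :=
  Bijection (bijection_inv_bij f).

Fact bijection_mulA : associative bijection_mul.
Proof. by move=> f g h; apply/val_inj. Qed.
Fact bijection_mul1 : left_id bijection_one bijection_mul.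
Proof. by move=> f; apply/val_inj. Qed.
Fact bijection_mulr1 : right_id bijection_one bijection_mul.
Proof. by move=> f; apply/val_inj. Qed.
Fact bijection_mulV : left_inverse bijection_one bijection_inv bijection_mul.
Proof. by move=> f; apply/val_inj/funext => x; exact: bijection_funK. Qed.
Fact bijection_mulrV : right_inverse bijection_one bijection_inv bijection_mul.
Proof. by move=> f; apply/val_inj/funext => x; exact: bijection_invK. Qed.

HB.instance Definition _ :=
  isGroup.Build bijection bijection_mulA bijection_mul1 bijection_mulr1
    bijection_mulV bijection_mulrV.

End Bijections.

Section ShiftsDecimations.
Variables (R : realType) (l : nat).

Definition Zvec : choiceType := {ffun Zmod l -> R[i]}.

Definition cshift_fun (j : Zmod l) (v : Zvec) : Zvec := [ffun i => v (i - j)].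
Definition decim_fun (k : Zunit l) (v : Zvec) : Zvec :=
  [ffun i => v (i * Zuval k^-1%g)].

Fact cshift_bij (j : Zmod l) : `[< bijective (cshift_fun j) >].
Proof.
apply/asboolP; exists (cshift_fun (- j)) => v; apply/ffunP => i;
  by rewrite !ffunE opprK ?addrK ?subrK.
Qed.

Fact decim_bij (k : Zunit l) : `[< bijective (decim_fun k) >].
Proof.
have kV : Zuval k * Zuval k^-1%g = 1 by rewrite mulrC; exact: Zunit_mulVr.
apply/asboolP; exists (decim_fun k^-1%g) => v; apply/ffunP => i;
  by rewrite !ffunE invgK -mulrA ?kV 1?[_ * Zuval k]mulrC ?kV mulr1.
Qed.

Definition cshift (j : Zmod l) : bijection Zvec := Bijection (cshift_bij j).
Definition decim (k : Zunit l) : bijection Zvec := Bijection (decim_bij k).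

End ShiftsDecimations.

Definition generated_subgroup (G : groupType) (S : set G) : set G :=
  smallest (fun A : set G => group_closed (mem A)) S.

(* Isomorphism of the subgroups A of G and B of H; only the values of f on A   *)
(* matter, and a whole group is represented by its full subset.                *)
Definition isomorphic (G H : groupType) (A : set G) (B : set H) : Prop :=
  exists f : G -> H,
    (forall x y, A x -> A y -> f (x * y)%g = (f x * f y)%g) /\ set_bij A B f.

(* Main.v *)
Require Import Defs.
From mathcomp Require Import all_boot all_order all_fingroup all_algebra.
From mathcomp Require Import all_classical all_reals.
From mathcomp Require Import complex.

(** The composite [cshift a \o decim k] sends a vector [v] to
    [i |-> v (k^-1 * (i - a))]: it moves the entry at position [m] to position
    [a + k * m].  So shifts and decimations permute positions by the affine
    maps of Z_l, and composing affine maps is the multiplication of the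
    semidirect product: [(a, k) |-> cshift a \o decim k] is a group morphism
    ([affineM]).  It is faithful because the vector with a single 1 in position
    [m] goes to the one with a single 1 in position [a + k * m], so the cases
    [m = 0] and [m = 1] recover [a] and then [k] ([affine_inj]).

    Shifts and decimations are the restrictions of this embedding to the two
    factors, embedded by [i |-> (i, 1)] and [k |-> (0, k)].  Each generating
    set in the theorem is thus the range of an injective morphism, hence
    already a subgroup, except for the one in (i), which generates the range of
    the whole embedding since [(a, k) = (a, 1) (0, k)].  All the isomorphisms
    then follow from one fact: the ranges of two injective morphisms out of the
    same group are isomorphic ([isomorphic_range]). *)

Local Open Scope classical_set_scope.

(** * Generated subgroups and ranges of morphisms *)

Section GroupMorphisms.
Set Implicit Arguments.
Unset Strict Implicit.
Variable K : groupType.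

Lemma generated_subgroupM (S : set K) (x y : K) :
  generated_subgroup S x -> generated_subgroup S y ->
  generated_subgroup S (x * y)%g.
Proof.
move=> Sx Sy A [Acl SA].
have [/mem_set xA /mem_set yA] : A x /\ A y by split; [apply: Sx | apply: Sy].
exact/set_mem/(group_closedM Acl).
Qed.

Lemma group_closed_range (H : groupType) (f : K -> H) :
  {morph f : x y / (x * y)%g} -> group_closed (mem (range f)).
Proof.
move=> fM; split.
  by apply/mem_set; exists 1%g => //; apply: (mulgI (f 1%g)); rewrite -fM !mulg1.
move=> _ _ /set_mem[x _ <-] /set_mem[y _ <-]; apply/mem_set.
exists (x * y^-1)%g => //.
by apply: (mulIg (f y)); rewrite -fM !mulgVK.
Qed.

Lemma generated_subgroup_range (H : groupType) (f : K -> H) :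
  {morph f : x y / (x * y)%g} -> generated_subgroup (range f) = range f.
Proof. by move=> fM; apply/smallest_id/group_closed_range. Qed.

(** The isomorphism inverts [f1] on its range and then applies [f2]. *)
Lemma isomorphic_range (H1 H2 : groupType) (f1 : K -> H1) (f2 : K -> H2) :
  {morph f1 : x y / (x * y)%g} -> injective f1 ->
  {morph f2 : x y / (x * y)%g} -> injective f2 ->
  isomorphic (range f1) (range f2).
Proof.
move=> f1M f1I f2M f2I.
pose g y := xget 1%g (f1 @^-1` [set y]).
have f1K x : g (f1 x) = x.
  apply: f1I.
  by apply: (xgetPex 1%g (_ : exists z, (f1 @^-1` [set f1 x]) z)); exists x.
exists (f2 \o g); split=> [_ _ [x _ <-] [y _ <-] /=|].
  by rewrite -f1M !f1K f2M.
split=> [_ [x _ <-]|_ _ /set_mem[x _ <-] /set_mem[y _ <-]|_ [x _ <-]] /=.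
- by rewrite f1K; exists x.
- by rewrite !f1K => /f2I ->.
- by exists (f1 x); [exists x | rewrite /= f1K].
Qed.

(** The whole group is the range of its identity morphism. *)
Lemma isomorphic_range_setT (H : groupType) (f : K -> H) :
  {morph f : x y / (x * y)%g} -> injective f -> isomorphic (range f) [set: K].
Proof.
move=> fM fI; rewrite -[X in isomorphic _ X](image_id [set: K]).
exact: isomorphic_range.
Qed.

End GroupMorphisms.

(** * The affine action on vectors *)

Section AffineAction.
Set Implicit Arguments.
Unset Strict Implicit.
Variables (R : realType) (l : nat).
Local Open Scope ring_scope.
Import GRing.Theory.

Lemma Zunit_mulrV (k : Zunit l) : Zuval k * Zuval k^-1%g = 1.
Proof. by rewrite mulrC; exact: Zunit_mulVr. Qed.

Definition sdprodZ_shift (i : Zmod l) : sdprodZ l := (i, 1%g).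
Definition sdprodZ_unit (k : Zunit l) : sdprodZ l := (0, k).

Lemma sdprodZ_eq (x y : sdprodZ l) : x.1 = y.1 -> x.2 = y.2 -> x = y.
Proof. exact: injective_projections. Qed.

Lemma sdprodZ_shiftM : {morph sdprodZ_shift : i j / (i * j)%g}.
Proof.
by move=> i j; apply: sdprodZ_eq; rewrite /= ?mulg1 // /theta mul1r.
Qed.

Lemma sdprodZ_unitM : {morph sdprodZ_unit : k m / (k * m)%g}.
Proof.
by move=> k m; apply: sdprodZ_eq; rewrite //= /theta mulr0 addr0.
Qed.

Lemma sdprodZ_shift_inj : injective sdprodZ_shift.
Proof. by move=> i j []. Qed.

Lemma sdprodZ_unit_inj : injective sdprodZ_unit.
Proof. by move=> k m []. Qed.

Lemma sdprodZE (x : sdprodZ l) :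
  x = (sdprodZ_shift x.1 * sdprodZ_unit x.2)%g.
Proof.
by apply: sdprodZ_eq; rewrite /= ?mul1g // /theta mulr0 addr0.
Qed.

Definition affine (x : sdprodZ l) : bijection (Zvec R l) :=
  (cshift R x.1 * decim R x.2)%g.

Lemma affineE (x : sdprodZ l) (v : Zvec R l) (i : Zmod l) :
  (affine x v : Zvec R l) i = v ((i - x.1) * Zuval x.2^-1%g).
Proof. by rewrite !ffunE. Qed.

Lemma bijectionP (T : choiceType) (f g : bijection T) : f =1 g -> f = g.
Proof. by move=> fg; apply/val_inj/funext. Qed.

Lemma affineM : {morph affine : x y / (x * y)%g}.
Proof.
move=> [a k] [b m]; apply: bijectionP => v; apply/ffunP => i.
rewrite [RHS]affineE !affineE; congr (v _).
(* Both sides are spelled out because simplification would also expand the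
   inverses of units into [Zp_inv]. *)
rewrite -[LHS]/((i - (a + theta k b)) * Zuval (k * m)^-1%g).
rewrite -[RHS]/(((i - a) * Zuval k^-1%g - b) * Zuval m^-1%g).
rewrite invMg -[Zuval (_ * _)%g]/(Zuval m^-1%g * Zuval k^-1%g).
rewrite opprD addrA [theta k b]mulrC [_ * Zuval k^-1%g]mulrC.
by rewrite mulrA [X in X * _]mulrBl -[X in _ - X]mulrA Zunit_mulrV mulr1.
Qed.

(** The standard basis of the space of vectors, on which an affine map acts
    through the positions alone. *)
Definition zdelta (m : Zmod l) : Zvec R l := [ffun i => (i == m)%:R].

Lemma affine_zdelta (x : sdprodZ l) (m : Zmod l) :
  affine x (zdelta m) = zdelta (x.1 + theta x.2 m).
Proof.
apply/ffunP => i; rewrite affineE !ffunE; congr (_%:R : R[i]); congr nat_of_bool.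
rewrite /theta; apply/eqP/eqP => [<-|->].
  by rewrite mulrCA Zunit_mulrV mulr1 addrC subrK.
by rewrite addrC addKr mulrAC Zunit_mulrV mul1r.
Qed.

Lemma zdelta_inj : injective zdelta.
Proof.
move=> m n /ffunP/(_ m); rewrite !ffunE eqxx; case: eqP => // _ /eqP.
by rewrite oner_eq0.
Qed.

(** Following the basis vectors at positions 0 and 1 recovers both coordinates. *)
Lemma affine_inj : injective affine.
Proof.
move=> [a k] [b m] E.
have Em n : a + theta k n = b + theta m n.
  by apply: zdelta_inj; rewrite -!(affine_zdelta (_, _)) E.
have ab : a = b by have := Em 0; rewrite /theta !mulr0 !addr0.
congr (_, _) => //; apply: val_inj.
by have := Em 1; rewrite ab /theta !mulr1 => /addrI.
Qed.

Lemma affine_shift (i : Zmod l) : affine (sdprodZ_shift i) = cshift R i.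
Proof.
apply: bijectionP => v; apply/ffunP => n.
by rewrite affineE !ffunE invg1 mulr1.
Qed.

Lemma affine_unit (k : Zunit l) : affine (sdprodZ_unit k) = decim R k.
Proof.
by apply: bijectionP => v; apply/ffunP => n; rewrite affineE !ffunE subr0.
Qed.

(** Shifts and decimations inherit their morphism laws and injectivity from the
    affine action, as its composites with the two embeddings. *)
Lemma cshiftM : {morph @cshift R l : i j / (i * j)%g}.
Proof. by move=> i j; rewrite -!affine_shift sdprodZ_shiftM affineM. Qed.

Lemma decimM : {morph @decim R l : k m / (k * m)%g}.
Proof. by move=> k m; rewrite -!affine_unit sdprodZ_unitM affineM. Qed.

Lemma cshift_inj : injective (@cshift R l).
Proof.
by move=> i j; rewrite -!affine_shift => /affine_inj/sdprodZ_shift_inj.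
Qed.

Lemma decim_inj : injective (@decim R l).
Proof. by move=> k m; rewrite -!affine_unit => /affine_inj/sdprodZ_unit_inj. Qed.

(** The range of [affine] is a subgroup containing every shift and decimation,
    and each of its elements is a shift times a decimation. *)
Lemma generated_decim_cshift :
  generated_subgroup (range (@decim R l) `|` range (@cshift R l)) = range affine.
Proof.
apply/seteqP; split.
  apply: smallest_sub; first exact/group_closed_range/affineM.
  move=> _ [] [y _ <-].
    by exists (sdprodZ_unit y) => //; rewrite affine_unit.
  by exists (sdprodZ_shift y) => //; rewrite affine_shift.
move=> _ [x _ <-]; rewrite [x]sdprodZE affineM affine_shift affine_unit.
apply: generated_subgroupM; apply: sub_gen_smallest.
  by right; exists x.1.
by left; exists x.2.
Qed.

End AffineAction.

Theorem proposition2p4 (R : realType) (l : nat) (hl : (0 < l)%N) :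
  [/\ isomorphic
        (generated_subgroup (range (@decim R l) `|` range (@cshift R l)))
        [set: sdprodZ l],
      isomorphic
        (generated_subgroup (range (fun i : Zmod l => (i, 1%g) : sdprodZ l)))
        (generated_subgroup (range (@cshift R l)))
      /\ isomorphic (generated_subgroup (range (@cshift R l))) [set: Zmod l]
    & isomorphic
        (generated_subgroup (range (fun k : Zunit l => (0%R, k) : sdprodZ l)))
        (generated_subgroup (range (@decim R l)))
      /\ isomorphic (generated_subgroup (range (@decim R l))) [set: Zunit l]].
Proof.
rewrite generated_decim_cshift.
rewrite (generated_subgroup_range (@cshiftM R l)).
rewrite (generated_subgroup_range (@decimM R l)).
rewrite (generated_subgroup_range (@sdprodZ_shiftM l)).
rewrite (generated_subgroup_range (@sdprodZ_unitM l)).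
split; [|split|split].
- exact: isomorphic_range_setT (@affineM R l) (@affine_inj R l).
- exact: isomorphic_range (@sdprodZ_shiftM l) (@sdprodZ_shift_inj l)
    (@cshiftM R l) (@cshift_inj R l).
- exact: isomorphic_range_setT (@cshiftM R l) (@cshift_inj R l).
- exact: isomorphic_range (@sdprodZ_unitM l) (@sdprodZ_unit_inj l)
    (@decimM R l) (@decim_inj R l).
- exact: isomorphic_range_setT (@decimM R l) (@decim_inj R l).
Qed.
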